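(* Let $q>2$ be a prime power and let $u,v$ be arbitrary non-zero elements of $\mathbb{F}_q$. Set $\theta=\theta(q-1)$, $\tau=\tau(q-1)$, $W=W(q-1)$. Then $$\left| N(q,u,v) - \theta^3\tau\,(q-1)\, q\right| \leq \theta^4 W^3\,(q-1)\sqrt{q}.$$
   Context: $\mathbb{F}_q$ is the finite field of order $q$. A primitive element of $\mathbb{F}_q$ is a generator of the cyclic group $\mathbb{F}_q^*$. For non-zero $u,v\in\mathbb{F}_q$, a pair $(a,b)$ of primitive elements of $\mathbb{F}_q$ is called $(u,v)$-primitive if additionally $ua+vb$ and $va^{-1}+ub^{-1}$ are both primitive; $N(q,u,v)$ denotes the number of $(u,v)$-primitive pairs in $\mathbb{F}_q$. For a positive integer $m$: $\omega(m)$ is the number of distinct prime divisors of $m$, $W(m)=2^{\omega(m)}$, $\theta(m)=\phi(m)/m$ with $\phi$ Euler's function, and $\tau(m)=\prod_{l\mid m}\left(1-\frac{1}{l-1}+\frac{1}{(l-1)^2}\right)$, the product over the distinct primes $l$ dividing $m$. *)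

(* Defs.v *)
From HB Require Import structures.
From mathcomp Require Import all_boot all_order all_algebra all_field.
Set Implicit Arguments. Unset Strict Implicit. Unset Printing Implicit Defensive.
Import Order.TTheory GRing.Theory Num.Theory.
Local Open Scope ring_scope.

(* a is primitive in F: a generates the cyclic group F^*, i.e. a is a
   primitive (#|F|-1)-th root of unity. *)
Definition primitive_elt (F : finFieldType) (a : F) : bool :=
  (#|F|.-1).-primitive_root a.

Definition uv_primitive (F : finFieldType) (u v : F) (p : F * F) : bool :=
  [&& primitive_elt p.1, primitive_elt p.2,
      primitive_elt (u * p.1 + v * p.2) &
      primitive_elt (v * p.1^-1 + u * p.2^-1)].

Definition Nuv (F : finFieldType) (u v : F) : nat :=
  #|[set p : F * F | uv_primitive u v p]|.

Definition omega (m : nat) : nat := size (primes m).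
Definition Wf (m : nat) : nat := 2 ^ omega m.
Definition thetaf (R : numFieldType) (m : nat) : R := (totient m)%:R / m%:R.
Definition tauf (R : numFieldType) (m : nat) : R :=
  \prod_(l <- primes m)
     (1 - 1 / (l%:R - 1) + 1 / ((l%:R - 1) ^+ 2)).

(* Main.v *)
(* Since v/a + u/b = (ua + vb)/(ab), expanding the four primitivity indicators in multiplicative
   characters turns every character sum into an orthogonality sum over F^* times a Jacobi sum,
   so that only the elementary evaluation |J|^2 = q is needed and no Weil bound.  The indicator
   of ua + vb is expanded in conjugate characters: the main term then comes exactly from the
   quadruples of equal characters, each contributing (q-1)(q-2), and replacing q-2 by q costs
   2 <= sqrt q per quadruple when q >= 4; the case q = 3 is separate.  For the error, the
   orthogonality sum determines the fourth character from the other three, so the weights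
   sum to at most W^3.  The characters live in algC; since theta and tau are rational, squaring
   the bound transfers it to any real closed field. *)
Require Import Defs.
From HB Require Import structures.
From mathcomp Require Import all_boot all_order all_algebra all_field.
From mathcomp Require Import all_solvable ring lra.
Import Order.TTheory GRing.Theory Num.Theory.
Local Open Scope ring_scope.

(** * Fourier expansion of coprimality over roots of unity *)

Lemma sum_expr_unity_root (K : fieldType) (n : nat) (y : K) :
  y ^+ n = 1 -> y != 1 -> \sum_(j < n) y ^+ j = 0.
Proof.
move=> yn1 yN1; have /eqP := subrX1 y n.
by rewrite yn1 subrr eq_sym mulf_eq0 subr_eq0 (negPf yN1) => /eqP.
Qed.

(** The sum of [z ^+ (i * j)] over all [j < l] is [l] or 0 according as [l] divides [i] or not, so
    the indicator is 1 minus that sum over [l]. Factoring out [1 - l%:R^-1] leaves the weights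
    shown. *)
Lemma ndvdn_fourier (K : numFieldType) (l : nat) (z : K) (i : nat) :
  prime l -> l.-primitive_root z ->
  (~~ (l %| i)%N)%:R =
  (1 - l%:R^-1) *
  \sum_(j < l) (if val j == 0%N then 1 else - (l%:R - 1)^-1) * (z ^+ j) ^+ i.
Proof.
case: l => // l pr_l z_l; have l_gt1 := prime_gt1 pr_l.
have l_neq0 : l%:R != 0 :> K by rewrite pnatr_eq0 -lt0n.
have lS_neq0 : l%:R + 1 != 0 :> K by rewrite natr1 pnatr_eq0.
have swap (j : nat) : (z ^+ j) ^+ i = (z ^+ i) ^+ j by rewrite -!exprM mulnC.
have tailE : \sum_(j < l.+1) (z ^+ i) ^+ j = 1 + \sum_(j < l) (z ^+ i) ^+ j.+1.
  by rewrite big_ord_recl expr0.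
rewrite big_ord_recl /= expr0 expr1n mulr1.
under eq_bigr => j _ do rewrite swap.
rewrite -mulr_sumr -!natr1 addrK (prim_order_dvd z_l).
have [zi1|ziN1] := eqVneq (z ^+ i) 1.
  under eq_bigr => j _ do rewrite zi1 expr1n.
  by rewrite sumr_const card_ord mulNr mulVf // subrr mulr0.
have : \sum_(j < l.+1) (z ^+ i) ^+ j = 0.
  by apply: sum_expr_unity_root => //; rewrite -exprM mulnC exprM (prim_expr_order z_l) expr1n.
rewrite tailE => /eqP; rewrite addrC addr_eq0 => /eqP ->.
by rewrite mulrNN mulr1 [LHS]/=; field; rewrite lS_neq0 l_neq0.
Qed.

(* The weights [h] are [mu(d)/phi(d)], [d] running over the orders of the roots of unity [w t]. *)
Lemma coprime_fourier (s : seq nat) : uniq s -> all prime s ->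
  exists (T : finType) (h w : T -> algC),
  [/\ injective w /\ (forall t, w t ^+ (\prod_(l <- s) l) = 1),
      forall t, h t \is Num.real /\ `|h t| <= 1,
      \sum_t `|h t| = 2 ^+ size s,
      \sum_t h t ^+ 4 = \prod_(l <- s) (1 + (l%:R - 1) ^- 3) &
      forall i, (all (fun l => ~~ (l %| i)%N) s)%:R =
        \prod_(l <- s) (1 - l%:R^-1) * \sum_t h t * w t ^+ i].
Proof.
elim: s => [_ _|l s IHs /= /andP[lNs Us] /andP[pr_l pr_s]].
  exists unit, (fun=> 1), (fun=> 1); split=> [|t|||i]; rewrite ?big_nil.
  - by split=> [[] []|].
  - by rewrite normr1 real1.
  - by rewrite sumr_const card_unit normr1.
  - by rewrite sumr_const card_unit expr1n.
  - by rewrite sumr_const card_unit expr1n !mul1r.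
have [T [h [w [[w_inj w1] h_bd h_sum h4_sum h_ind]]]] := IHs Us pr_s.
have [z z_l] := C_prim_root_exists (prime_gt0 pr_l).
pose hl (j : 'I_l) : algC := if val j == 0%N then 1 else - (l%:R - 1)^-1.
have l_gt1 := prime_gt1 pr_l.
have lN1 : l%:R - 1 = l.-1%:R :> algC.
  by rewrite -[l in LHS](ltn_predK l_gt1) -natr1 addrK.
have l1_neq0 : l.-1%:R != 0 :> algC by rewrite pnatr_eq0 -lt0n -ltnS (ltn_predK l_gt1).
have l1_ge1 : 1 <= l.-1%:R :> algC.
  by rewrite (ler_nat _ 1) -ltnS (ltn_predK l_gt1).
(* One weight is 1 and the other [l.-1] are [- l.-1%:R^-1], so absolute values sum to 2 and fourth
   powers to [1 + (l%:R - 1) ^- 3]. *)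
have sum_l (G : algC -> algC) : \sum_j G (hl j) = G 1 + G (- l.-1%:R^-1) *+ l.-1.
  rewrite /hl lN1; case: (l) l_gt1 => // k _.
  by rewrite big_ord_recl /= sumr_const card_ord.
exists ('I_l * T)%type, (fun p : 'I_l * T => hl p.1 * h p.2),
  (fun p : 'I_l * T => z ^+ p.1 * w p.2).
split.
- have co_l : coprime l (\prod_(k <- s) k).
    rewrite prime_coprime // big_seq; elim/big_ind: _ => [||k k_s].
    - by rewrite dvdn1; case: eqP l_gt1 => // ->.
    - by move=> a b /negPf la /negPf lb; rewrite Euclid_dvdM // la lb.
    - by rewrite dvdn_prime2  ?(allP pr_s k k_s) //; apply: contraNN lNs => /eqP ->.
  split=> [[j t] [j' t'] /= eq_w|[j t] /=].
  (* Raising to the product over [s] kills [w t] and keeps [z] primitive, [l] being coprime to that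
     product; hence [j] is determined, and then [t]. *)
  + have /eqP := congr1 (fun x => x ^+ (\prod_(k <- s) k)) eq_w.
    have z_M : l.-primitive_root (z ^+ (\prod_(k <- s) k)).
      by rewrite prim_root_exp_coprime // coprime_sym.
    rewrite /= !exprMn !w1 !mulr1 -!exprM ![(_ * \prod_(k <- s) k)%N]mulnC !exprM.
    rewrite (eq_prim_root_expr z_M) !modn_small //.
    move/eqP/val_inj => eq_j; move: eq_w; rewrite eq_j => /mulfI eq_w.
    by rewrite (w_inj _ _ (eq_w _)) // expf_neq0 // (prim_root_eq0 z_l) -lt0n prime_gt0.
  + rewrite big_cons exprMn -exprM mulnCA exprM (prim_expr_order z_l) expr1n mul1r.
    by rewrite mulnC exprM w1 expr1n.
- move=> [j t] /=; have [h_real h_le1] := h_bd t.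
  have [hl_real hl_le1] : hl j \is Num.real /\ `|hl j| <= 1.
    rewrite /hl lN1; case: ifP => _; first by rewrite normr1 real1.
    by rewrite normrN normfV normr_nat invf_le1 ?rpredN ?rpredV ?realn // lt0r l1_neq0 ler0n.
  by rewrite realM // normrM mulr_ile1.
- rewrite -(pair_bigA _ (fun j t => `|hl j * h t|)) /=.
  under eq_bigr => j _ do under eq_bigr => t _ do rewrite normrM.
  rewrite -big_distrlr /= h_sum exprS (sum_l (fun x => `|x|)).
  by rewrite normr1 normrN normfV normr_nat -[_^-1 *+ _]mulr_natr mulVf.
- rewrite -(pair_bigA _ (fun j t => (hl j * h t) ^+ 4)) /=.
  under eq_bigr => j _ do under eq_bigr => t _ do rewrite exprMn.
  rewrite -big_distrlr /= h4_sum big_cons (sum_l (fun x => x ^+ 4)) lN1.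
  by rewrite -[_ ^+ 4 *+ _]mulr_natr; congr (_ * _); field.
- move=> i; rewrite big_cons -mulnb natrM h_ind (ndvdn_fourier _ _ _ i pr_l z_l).
  rewrite mulrACA big_distrlr pair_bigA; congr (_ * _).
  by apply: eq_bigr => -[j t] _ /=; rewrite exprMn mulrACA.
Qed.

(** * Multiplicative characters and Jacobi sums *)

Definition mult_char {F : finFieldType} (chi : F -> algC) :=
  [/\ chi 0 = 0, chi 1 = 1 & {morph chi : x y / x * y >-> x * y}].

(** The condition [x != 0] matters: every character vanishes at 0, even the trivial one. *)
Definition nontrivial {F : finFieldType} (chi : F -> algC) :=
  [exists x, (x != 0) && (chi x != 1)].

Lemma trivialP {F : finFieldType} (chi : F -> algC) :
  ~~ nontrivial chi -> forall x, x != 0 -> chi x = 1.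
Proof.
by rewrite negb_exists => /forallP chi1 x x0; have := chi1 x; rewrite x0 negbK => /eqP.
Qed.

Lemma mult_charM {F : finFieldType} {chi psi : F -> algC} :
  mult_char chi -> mult_char psi -> mult_char (fun x => chi x * psi x).
Proof.
case=> chi0 chi1 chiM [psi0 psi1 psiM]; split; rewrite ?chi0 ?mul0r ?chi1 ?psi1 ?mulr1 //.
by move=> x y; rewrite chiM psiM mulrACA.
Qed.

Lemma mult_charJ {F : finFieldType} {chi : F -> algC} :
  mult_char chi -> mult_char (fun x => (chi x)^*).
Proof.
case=> chi0 chi1 chiM; split; rewrite ?chi0 ?rmorph0 ?chi1 ?rmorph1 //.
by move=> x y; rewrite chiM rmorphM.
Qed.

(** Since [x ^+ #|F| = x], the value [chi x] is a root of unity. *)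
Lemma norm_mult_char {F : finFieldType} (chi : F -> algC) (x : F) :
  mult_char chi -> x != 0 -> `|chi x| = 1.
Proof.
case=> chi0 chi1 chiM x0; apply/eqP.
have chiX n : chi (x ^+ n) = chi x ^+ n.
  by elim: n => [|n IHn]; rewrite ?expr0 // !exprS chiM IHn.
have q0 : (0 < #|F|.-1)%N by rewrite -ltnS prednK ?finNzRing_gt1 // (ltn_trans _ (finNzRing_gt1 F)).
rewrite -(@pexpr_eq1 _ _ #|F|.-1) // -normrX -chiX.
suff -> : x ^+ #|F|.-1 = 1 by rewrite chi1 normr1.
apply: (mulfI x0); rewrite -exprS prednK ?expf_card ?mulr1 //.
exact: ltn_trans (finNzRing_gt1 F).
Qed.

Lemma mult_charK {F : finFieldType} (chi : F -> algC) (x : F) :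
  mult_char chi -> x != 0 -> (chi x) * (chi x)^* = 1.
Proof. by move=> chi_m x0; rewrite -normCK norm_mult_char // expr1n. Qed.

Lemma mult_charV {F : finFieldType} (chi : F -> algC) (x : F) :
  mult_char chi -> x != 0 -> chi x^-1 = (chi x)^*.
Proof.
move=> chi_m x0; have [_ chi1 chiM] := chi_m.
have chi_x0 : chi x != 0 by rewrite -normr_eq0 norm_mult_char // oner_eq0.
by apply: (mulfI chi_x0); rewrite mult_charK // -chiM mulfV.
Qed.

(** Multiplying the variable by some [a] with [chi a != 1] permutes the terms and scales the sum by
    [chi a]. *)
Lemma sum_mult_char {F : finFieldType} (chi : F -> algC) :
  mult_char chi -> nontrivial chi -> \sum_x chi x = 0.
Proof.
case=> _ _ chiM /existsP[a /andP[a0 chi_a]].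
have : \sum_x chi x = chi a * \sum_x chi x.
  rewrite mulr_sumr [LHS](reindex_onto ( *%R a) ( *%R a^-1)) /=; last by move=> x _; rewrite mulVKf.
  by apply: eq_big => [x|x _]; rewrite ?mulKf ?eqxx // chiM.
move/eqP; rewrite -subr_eq0 -{1}[\sum_x _]mul1r -mulrBl mulf_eq0 subr_eq0 eq_sym.
by rewrite (negPf chi_a) => /eqP.
Qed.

(* The substitution [y = s + r / x] reaches every value but [s]. *)
Lemma sum_mult_char_affine {F : finFieldType} (chi : F -> algC) (r s : F) :
  mult_char chi -> nontrivial chi -> r != 0 ->
  \sum_x chi (r + s * x) * (chi x)^* = - chi s.
Proof.
move=> chi_m chi_nt r0; have [chi0 chi1 chiM] := chi_m.
rewrite (bigD1 0) //= chi0 rmorph0 mulr0 add0r.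
transitivity (\sum_(y | y != s) chi y); last first.
  apply/eqP; rewrite -addr_eq0 addrC.
  by have := sum_mult_char _ chi_m chi_nt; rewrite (bigD1 s) //= => ->.
rewrite [RHS](reindex_onto (fun x => s + r / x) (fun y => r / (y - s))) /=; last first.
  by move=> y y_s; rewrite invf_div mulrCA mulfV // mulr1 subrKC.
apply: eq_big => [x|x x0].
  have [->|x0] := eqVneq x 0; first by rewrite invr0 mulr0 addr0 eqxx.
  rewrite [s + _]addrC addrK invf_div mulrCA mulfV // mulr1 eqxx andbT.
  by rewrite -subr_eq0 addrK mulf_neq0 ?invr_eq0.
by rewrite -mult_charV // -chiM mulrDl mulfK // addrC.
Qed.

(** The classical Jacobi sum has [1 - t]; this one differs by the factor [chi (-1)], of modulus 1,
    and matches the form [u * a + v * b]. *)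
Definition jacobi_sum {F : finFieldType} (chi psi : F -> algC) :=
  \sum_t chi t * psi (1 + t).

(** In the double sum for the squared modulus, put [s = t * r]. The sum over [t] is then an affine
    character sum, and orthogonality over [r] leaves only the contribution [#|F|] of [r = 1]. *)
Lemma sqr_norm_jacobi_sum {F : finFieldType} (chi psi : F -> algC) :
  mult_char chi -> mult_char psi ->
  nontrivial chi -> nontrivial psi -> nontrivial (fun x => chi x * psi x) ->
  `|jacobi_sum chi psi| ^+ 2 = #|F|%:R.
Proof.
move=> chi_m psi_m chi_nt psi_nt cp_nt.
have [chi0 chi1 chiM] := chi_m; have [psi0 psi1 psiM] := psi_m.
have sum_psi r : r != 0 ->
    \sum_t psi (1 + t * r) * (psi (1 + t))^* = (r == 1)%:R * #|F|%:R - psi r.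
  move=> r0; have [->|r1] := eqVneq r 1.
    rewrite mul1r psi1 (bigD1 (-1)) //= mulr1 addrN psi0 mul0r add0r.
    rewrite (eq_bigr (fun=> 1)) => [|t tN1]; last first.
      by rewrite mulr1 mult_charK // addrC addr_eq0.
    rewrite sumr_const (eq_card (fun t => erefl : _ = (t \in predC1 (-1)))) cardC1.
    by rewrite -subn1 natrB // (ltn_trans _ (finNzRing_gt1 F)).
  rewrite mul0r add0r -(sum_mult_char_affine _ (1 - r) r psi_m psi_nt) ?subr_eq0 1?eq_sym //.
  rewrite [RHS](reindex_inj (addrI 1)); apply: eq_bigr => t _ /=.
  by congr (psi _ * _); ring.
have dil (t : F) (G : F -> algC) : t != 0 -> \sum_s G s = \sum_r G (t * r).
  by move=> t0; rewrite (reindex_inj (mulfI t0)).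
rewrite normCK /jacobi_sum rmorph_sum mulr_sumr.
(* The substitution fails at [t = 0], where the original term is 0; the correction [(t == 0)%:R]
   cancels the spurious term there. *)
transitivity (\sum_t \sum_r chi r * (psi (1 + t * r) * (psi (1 + t))^* - (t == 0)%:R)).
  apply: eq_bigr => t _; have [->|t0] := eqVneq t 0.
    rewrite chi0 mul0r rmorph0 mulr0 big1 // => r _.
    by rewrite mul0r !addr0 mulr1n -normCK psi1 normr1 expr1n subrr mulr0.
  rewrite mulr_suml (dil t) //; apply: eq_bigr => r _.
  rewrite subr0 rmorphM chiM /= -[RHS]mul1r -(mult_charK chi t chi_m t0).
  by rewrite -!mulrA; congr (_ * _); rewrite [RHS]mulrCA; congr (_ * _); exact: mulrCA.
rewrite exchange_big /=.
have sum_delta (a : F) : \sum_t (t == a)%:R = 1 :> algC.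
  by rewrite (bigD1 a) //= eqxx big1 ?addr0 // => t /negPf ->.
transitivity (\sum_r ((r == 1)%:R * #|F|%:R - chi r * psi r - chi r)).
  apply: eq_bigr => r _; rewrite -mulr_sumr sumrB sum_delta.
  have [->|r0] := eqVneq r 0; first by rewrite chi0 !mul0r eq_sym oner_eq0 mul0r !subr0.
  by rewrite sum_psi //; have [->|_] := eqVneq r 1; rewrite ?chi1 /=; ring.
rewrite !sumrB -mulr_suml sum_delta !sum_mult_char // ?mul1r ?subr0 //.
exact: mult_charM.
Qed.

(** The summand vanishes at the distinct points 0 and -1 and is 1 elsewhere. *)
Lemma jacobi_sum_trivial {F : finFieldType} (chi psi : F -> algC) :
  mult_char chi -> mult_char psi -> ~~ nontrivial chi -> ~~ nontrivial psi ->
  jacobi_sum chi psi = #|F|%:R - 2.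
Proof.
move=> [chi0 _ _] [psi0 _ _] /trivialP chi1 /trivialP psi1.
rewrite /jacobi_sum (bigD1 0) //= (bigD1 (-1)) ?oppr_eq0 ?oner_eq0 //=.
rewrite chi0 mul0r addrN psi0 mulr0 !add0r (eq_bigr (fun=> 1)) => [|t /andP[t0 tN1]].
  have : \sum_(t : F) 1 = #|F|%:R :> algC by rewrite sumr_const.
  rewrite (bigD1 0) //= (bigD1 (-1)) ?oppr_eq0 ?oner_eq0 //= => <-.
  by rewrite addrA [1 + 1]/2%:R addrC addrK.
by rewrite chi1 // psi1 ?mulr1 // addrC addr_eq0.
Qed.

(** If one character or the product is trivial, the sum is a complete character sum with one term
    missing, so it has modulus 1. Otherwise its squared modulus is [#|F|]. *)
Lemma norm_jacobi_sum_le {F : finFieldType} (chi psi : F -> algC) :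
  mult_char chi -> mult_char psi -> nontrivial chi || nontrivial psi ->
  `|jacobi_sum chi psi| <= sqrtC #|F|%:R.
Proof.
move=> chi_m psi_m; have [chi0 chi1 chiM] := chi_m; have [psi0 psi1 psiM] := psi_m.
have le1 (J : algC) : `|J| = 1 -> `|J| <= sqrtC #|F|%:R.
  move=> ->; rewrite -[leLHS]sqrtC1 ler_sqrtC ?qualifE /= ?ler0n ?ler01 ?ler1n //.
  exact: ltn_trans (finNzRing_gt1 F).
have N10 : -1 != 0 :> F by rewrite oppr_eq0 oner_eq0.
have [chi_nt|/trivialP chi_t] /= := boolP (nontrivial chi); last first.
  move=> psi_nt; apply: le1; rewrite /jacobi_sum (bigD1 0) //= chi0 mul0r add0r.
  have := sum_mult_char _ psi_m psi_nt.
  rewrite (reindex_inj (addrI 1)) (bigD1 0) //= addr0 psi1 => /eqP.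
  rewrite addrC addr_eq0 => /eqP sumE.
  rewrite (eq_bigr (fun t => psi (1 + t))) => [|t t0]; last by rewrite chi_t ?mul1r.
  by rewrite sumE normrN normr1.
have [psi_nt _|/trivialP psi_t _] := boolP (nontrivial psi); last first.
  apply: le1; rewrite /jacobi_sum (bigD1 (-1)) //= addrN psi0 mulr0 add0r.
  have := sum_mult_char _ chi_m chi_nt; rewrite (bigD1 (-1)) //= => /eqP.
  rewrite addrC addr_eq0 => /eqP sumE.
  rewrite (eq_bigr chi) => [|t tN1]; last by rewrite psi_t ?mulr1 // addrC addr_eq0.
  by rewrite sumE normrN norm_mult_char.
have [cp_nt|/trivialP cp_t] := boolP (nontrivial (fun x => chi x * psi x)).
  rewrite -(@ler_pXn2r _ 2) ?nnegrE ?sqrtC_ge0 ?ler0n //.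
  by rewrite sqr_norm_jacobi_sum // sqrtCK.
(* A trivial product makes [psi] the conjugate of [chi]; shifting by 1 gives the affine sum with
   [r = -1] and [s = 1]. *)
apply: le1.
have psiE x : psi x = (chi x)^*.
  have [->|x0] := eqVneq x 0; first by rewrite psi0 chi0 rmorph0.
  by rewrite -[LHS]mul1r -(mult_charK chi x chi_m x0) mulrAC cp_t ?mul1r.
transitivity `|- chi 1|; last by rewrite normrN chi1 normr1.
rewrite -(sum_mult_char_affine _ (-1) 1 chi_m chi_nt N10); congr `|_|.
rewrite /jacobi_sum [RHS](reindex_inj (addrI 1)); apply: eq_bigr => t _ /=.
by rewrite mul1r addKr psiE.
Qed.

(** * Reduction of the two-variable sums to Jacobi sums *)

(** For [a != 0] the substitution [b = a * (u / v) * s] turns the linear form into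
    [u * (a * (1 + s))], which separates [a] from [s]. *)
Lemma sum_mult_char_linear_form {F : finFieldType} (chi psi phi : F -> algC) (u v : F) :
  mult_char chi -> mult_char psi -> mult_char phi -> u != 0 -> v != 0 ->
  \sum_a \sum_b chi a * psi b * phi (u * a + v * b) =
  psi (u / v) * phi u * (\sum_a chi a * psi a * phi a) * jacobi_sum psi phi.
Proof.
move=> [chi0 _ chiM] [psi0 _ psiM] [phi0 _ phiM] u0 v0.
rewrite -!mulrA !mulr_suml !mulr_sumr; apply: eq_bigr => a _.
have [->|a0] := eqVneq a 0.
  by rewrite chi0 !mul0r !mulr0 big1 // => b _; rewrite !mul0r.
have auv0 : a * (u / v) != 0 by rewrite !mulf_neq0 ?invr_eq0.
rewrite (reindex_inj (mulfI auv0)) /jacobi_sum !mulr_sumr; apply: eq_bigr => s _ /=.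
have -> : u * a + v * (a * (u / v) * s) = u * (a * (1 + s)) by field.
by rewrite !psiM !phiM; ring.
Qed.

(** The reciprocal form is the linear form divided by [a * b]. At [a = 0] or [b = 0], where the
    inverse takes its default value 0, both sides vanish through [chi1] or [chi2]. *)
Lemma reciprocal_form_char {F : finFieldType} (chi1 chi2 chi3 chi4 : F -> algC) (u v a b : F) :
  mult_char chi1 -> mult_char chi2 -> mult_char chi4 ->
  chi1 a * chi2 b * ((chi3 (u * a + v * b))^* * chi4 (v * a^-1 + u * b^-1)) =
  (chi1 a * (chi4 a)^*) * (chi2 b * (chi4 b)^*) *
    ((chi3 (u * a + v * b))^* * chi4 (u * a + v * b)).
Proof.
move=> [chi1_0 _ _] [chi2_0 _ _] chi4_m; have [_ _ chi4M] := chi4_m.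
have [->|a0] := eqVneq a 0; first by rewrite chi1_0 !mul0r.
have [->|b0] := eqVneq b 0; first by rewrite chi2_0 !mul0r !mulr0 !mul0r.
have -> : v * a^-1 + u * b^-1 = (u * a + v * b) * (a^-1 * b^-1).
  by field; rewrite a0 b0.
rewrite !chi4M !mult_charV //.
by move: (chi4 a)^* (chi4 b)^* (chi3 _)^* => x y z; ring.
Qed.

(** * Characters built from a discrete logarithm *)

(** For [log] a discrete logarithm to a primitive base and [w] a root of unity of order dividing
    [#|F|.-1], this is the character sending the base to [w]. *)
Definition pow_char {F : finFieldType} (log : F -> nat) (w : algC) (x : F) : algC :=
  if x == 0 then 0 else w ^+ log x.

(** Conjugating the third character makes all three reduced characters trivial when the four [w]
    agree. *)
Definition form_sum {F : finFieldType} (log : F -> nat) (u v : F) (w1 w2 w3 w4 : algC) :=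
  \sum_a \sum_b pow_char log w1 a * pow_char log w2 b *
    ((pow_char log w3 (u * a + v * b))^* * pow_char log w4 (v * a^-1 + u * b^-1)).

Lemma finField_prim_root_exists (F : finFieldType) :
  exists g : F, (#|F|.-1).-primitive_root g.
Proof.
have q_gt1 := finNzRing_gt1 F.
have q1_gt0 : (0 < #|F|.-1)%N by rewrite -ltnS (ltn_predK q_gt1).
pose rs := enum [pred x : F | x != 0].
have rs1 : all (#|F|.-1).-unity_root rs.
  apply/allP => x; rewrite mem_enum inE => x0; apply/unity_rootP.
  by apply: (mulfI x0); rewrite -exprS (ltn_predK q_gt1) expf_card mulr1.
have /hasP[g _ g_prim] : has (#|F|.-1).-primitive_root rs; last by exists g.
apply: has_prim_root; rewrite ?enum_uniq // -cardE.
by rewrite -(cardC1 (0 : F)); apply/eq_leq/eq_card => x; rewrite !inE.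
Qed.

Lemma finField_log_exists {F : finFieldType} (g : F) :
  (#|F|.-1).-primitive_root g -> exists log : F -> nat, forall x, x != 0 -> g ^+ log x = x.
Proof.
move=> g_prim; have q_gt1 := finNzRing_gt1 F.
suff /fin_all_exists[log logP] : forall x : F, exists i : nat, x != 0 -> g ^+ i = x by exists log.
move=> x; have [->|x0] := eqVneq x 0; first by exists 0%N.
have [|i ->] := @prim_rootP _ _ _ g_prim x; last by exists i.
by apply: (mulfI x0); rewrite -exprS (ltn_predK q_gt1) expf_card mulr1.
Qed.

Section PowChar.

Context (F : finFieldType) (g : F) (log : F -> nat).
Hypothesis g_prim : (#|F|.-1).-primitive_root g.
Hypothesis logK : forall x, x != 0 -> g ^+ log x = x.

Let q1_gt0 : (0 < #|F|.-1)%N.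
Proof. exact: prim_order_gt0 g_prim. Qed.

Let g_neq0 : g != 0.
Proof. by rewrite (prim_root_eq0 g_prim) -lt0n. Qed.

(** The logarithm is additive only modulo [#|F|.-1], which suffices because [w] has order dividing
    it. *)
Lemma pow_char_mult w : w ^+ #|F|.-1 = 1 -> mult_char (pow_char log w).
Proof.
have w_log w' i j : w' ^+ #|F|.-1 = 1 -> i = j %[mod #|F|.-1] -> w' ^+ i = w' ^+ j :> algC.
  by move=> w1 ij; rewrite -(expr_mod i w1) ij expr_mod.
have log_mod x y : g ^+ x = g ^+ y -> x = y %[mod #|F|.-1].
  by move/eqP; rewrite (eq_prim_root_expr g_prim) => /eqP.
move=> w1; split; rewrite /pow_char ?eqxx // ?oner_eq0.
  by rewrite -(expr0 w); apply/w_log/log_mod; rewrite ?logK ?oner_eq0.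
move=> x y; rewrite mulf_eq0.
have [_|x0] /= := eqVneq x 0; first by rewrite mul0r.
have [_|y0] /= := eqVneq y 0; first by rewrite mulr0.
by rewrite -exprD; apply/w_log/log_mod; rewrite // exprD !logK ?mulf_neq0.
Qed.

Lemma pow_char_gen w : w ^+ #|F|.-1 = 1 -> pow_char log w g = w.
Proof.
move=> w1; rewrite /pow_char (negPf g_neq0).
have /eqP : g ^+ log g = g ^+ 1 by rewrite logK.
by rewrite (eq_prim_root_expr g_prim) => /eqP eq1; rewrite -(expr_mod _ w1) eq1 expr_mod.
Qed.

Lemma norm_root1 (w : algC) : w ^+ #|F|.-1 = 1 -> w * w^* = 1.
Proof.
by move=> w1; rewrite -(pow_char_gen _ w1) mult_charK //; apply: pow_char_mult.
Qed.

(** The sum is a unit times an orthogonality sum times a Jacobi sum. The orthogonality sum vanishes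
    unless [w4 = w1 * w2 * w3^*]; the Jacobi factor exceeds [sqrtC #|F|%:R] only if [psi] and [phi]
    are trivial, which then forces all four [w] to agree. *)
Lemma norm_form_sum (u v : F) (w1 w2 w3 w4 : algC) :
  (3 < #|F|)%N -> u != 0 -> v != 0 ->
  w1 ^+ #|F|.-1 = 1 -> w2 ^+ #|F|.-1 = 1 -> w3 ^+ #|F|.-1 = 1 -> w4 ^+ #|F|.-1 = 1 ->
  `|form_sum log u v w1 w2 w3 w4
    - [&& w1 == w4, w2 == w4 & w3 == w4]%:R * #|F|.-1%:R * #|F|%:R|
  <= (w4 == w1 * w2 * w3^*)%:R * #|F|.-1%:R * sqrtC #|F|%:R.
Proof.
move=> q_gt3 u0 v0 w1_1 w2_1 w3_1 w4_1.
have m1 := pow_char_mult _ w1_1; have m2 := pow_char_mult _ w2_1.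
have m3 := pow_char_mult _ w3_1; have m4 := pow_char_mult _ w4_1.
pose chi x := pow_char log w1 x * (pow_char log w4 x)^*.
pose psi x := pow_char log w2 x * (pow_char log w4 x)^*.
pose phi x := (pow_char log w3 x)^* * pow_char log w4 x.
have chi_m : mult_char chi by exact: mult_charM m1 (mult_charJ m4).
have psi_m : mult_char psi by exact: mult_charM m2 (mult_charJ m4).
have phi_m : mult_char phi by exact: mult_charM (mult_charJ m3) m4.
(* Evaluation at the generator [g] recovers [w] from its character. *)
have triv_inj w w' : w ^+ #|F|.-1 = 1 -> w' ^+ #|F|.-1 = 1 ->
    pow_char log w g * (pow_char log w' g)^* = 1 -> w = w'.
  move=> w_1 w'_1; rewrite !pow_char_gen // => ww'.
  by rewrite -[w]mulr1 -(norm_root1 _ w'_1) mulrCA ww' mulr1.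
have -> : form_sum log u v w1 w2 w3 w4 =
    psi (u / v) * phi u * (\sum_a chi a * psi a * phi a) * jacobi_sum psi phi.
  rewrite -sum_mult_char_linear_form //; apply: eq_bigr => a _; apply: eq_bigr => b _.
  exact: reciprocal_form_char.
have cpp_m := mult_charM (mult_charM chi_m psi_m) phi_m.
have q_gt0 : (0 < #|F|)%N by apply: leq_trans q_gt3.
have sum_triv (G : F -> algC) : G 0 = 0 -> (forall x, x != 0 -> G x = 1) ->
    \sum_x G x = #|F|.-1%:R.
  move=> G0 G1; rewrite (bigD1 0) //= G0 add0r (eq_bigr (fun=> 1)) //.
  by rewrite sumr_const cardC1.
have [cpp_nt|/trivialP cpp_t] := boolP (nontrivial (fun x => chi x * psi x * phi x)).
  rewrite sum_mult_char // mulr0 mul0r sub0r normrN.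
  have -> : [&& w1 == w4, w2 == w4 & w3 == w4] = false.
    apply/negP => /and3P[/eqP e1 /eqP e2 /eqP e3].
    move: cpp_nt => /existsP[x /andP[x0 /eqP[]]].
    by rewrite /chi /psi /phi e1 e2 e3 mulrC [_^* * _]mulrC !mult_charK ?mulr1.
  by rewrite !mul0r normr0 !mulr_ge0 ?sqrtC_ge0 ?ler0n.
have w4E : w4 == w1 * w2 * w3^*.
  have := cpp_t g g_neq0; rewrite /chi /psi /phi !pow_char_gen // => cpp1.
  have w44 := norm_root1 _ w4_1; apply/eqP.
  rewrite -[LHS]mulr1 -cpp1 -[RHS]mulr1 -[1 in RHS](mulr1 1) -{1 2}w44.
  by move: w4^* w3^* => x y; ring.
rewrite w4E sum_triv //; last by case: cpp_m.
have cst1 : `|psi (u / v) * phi u| = 1.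
  by rewrite normrM !norm_mult_char ?mulr1 // mulf_neq0 ?invr_eq0.
rewrite mul1r.
have [nt|] := boolP (nontrivial psi || nontrivial phi).
  have -> : [&& w1 == w4, w2 == w4 & w3 == w4] = false.
    apply/negP => /and3P[/eqP e1 /eqP e2 /eqP e3].
    case/orP: nt => /existsP[x /andP[x0 /eqP[]]]; rewrite /psi /phi ?e2 ?e3.
      by rewrite mult_charK.
    by rewrite mulrC mult_charK.
  rewrite !mul0r subr0 normrM normrM cst1 mul1r normr_nat ler_wpM2l ?ler0n //.
  exact: norm_jacobi_sum_le.
rewrite negb_or => /andP[psi_t phi_t].
have psi1 := trivialP _ psi_t; have phi1 := trivialP _ phi_t.
have e2 : w2 = w4 by apply: triv_inj => //; apply: psi1.
have e3 : w3 = w4.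
  by apply/esym/triv_inj => //; rewrite mulrC; apply: phi1.
have e1 : w1 = w4.
  apply: triv_inj => //; have := cpp_t g g_neq0.
  by rewrite psi1 // phi1 // !mulr1.
rewrite e1 e2 e3 !eqxx jacobi_sum_trivial //= psi1 ?phi1 ?mulf_neq0 ?invr_eq0 //.
rewrite !mul1r mulrBr addrAC subrr sub0r normrN normrM !normr_nat.
(* What remains is [2 <= sqrtC #|F|%:R], the gap between [#|F| - 2] and [#|F|]; squared, it is
   [4 <= #|F|]. *)
rewrite ler_wpM2l ?ler0n // -(@ler_pXn2r _ 2) ?nnegrE ?sqrtC_ge0 ?ler0n //.
by rewrite sqrtCK -natrX ler_nat.
Qed.

End PowChar.

(** * Arithmetic of the main term and the count over [algC] *)

Lemma coprime_all_primes (i n : nat) : (0 < n)%N ->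
  coprime i n = all (fun l => ~~ (l %| i)%N) (primes n).
Proof.
move=> n_gt0; case: i => [|i]; last first.
  rewrite coprime_has_primes // -all_predC; apply: eq_in_all => l.
  by rewrite mem_primes => /andP[pr_l _]; rewrite /= mem_primes pr_l.
(* For [i = 0] both sides say [n = 1]: any prime factor of [n] divides 0. *)
rewrite /coprime gcd0n; have [->//|n_neq1] := eqVneq n 1%N.
have n_gt1 : (1 < n)%N by rewrite ltn_neqAle eq_sym n_neq1.
apply/esym/negP => /allP/(_ (pdiv n)).
by rewrite mem_primes pdiv_prime // n_gt0 pdiv_dvd dvdn0 => /(_ isT).
Qed.

Lemma thetaf_prod (K : numFieldType) (n : nat) : (0 < n)%N ->
  thetaf K n = \prod_(l <- primes n) (1 - l%:R^-1).
Proof.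
move=> n_gt0; rewrite /thetaf totientE // [in X in _ / X](prod_prime_decomp n_gt0).
rewrite prime_decompE big_map /= !natr_prod -prodfV -big_split /=.
apply: eq_big_seq => l; rewrite mem_primes => /and3P[pr_l _ l_n].
have l_gt0 := prime_gt0 pr_l.
have l_neq0 : l%:R != 0 :> K by rewrite pnatr_eq0 -lt0n.
have : (0 < logn l n)%N by rewrite logn_gt0 mem_primes pr_l n_gt0.
case: (logn l n) => // k _; rewrite natrM !natrX exprS -subn1 natrB //=.
by field; rewrite l_neq0 expf_neq0.
Qed.

(** Prime by prime, [(l - 1)^3 + 1 = l * ((l - 1)^2 - (l - 1) + 1)]. This converts [theta^4] times
    the sum of the fourth powers of the weights into [theta^3 * tau]. *)
Lemma thetaf_tauf (K : numFieldType) (n : nat) : (0 < n)%N ->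
  thetaf K n * \prod_(l <- primes n) (1 + (l%:R - 1) ^- 3) = tauf K n.
Proof.
move=> n_gt0; rewrite thetaf_prod // -big_split; apply: eq_big_seq => l /=.
rewrite mem_primes => /andP[/prime_gt1 l_gt1 _].
have l_neq0 : l%:R != 0 :> K by rewrite pnatr_eq0 -lt0n ltnW.
have l1_neq0 : l%:R - 1 != 0 :> K by rewrite subr_eq0 pnatr_eq1 neq_ltn l_gt1 orbT.
by field; rewrite l_neq0 l1_neq0.
Qed.

Lemma primitive_elt_coprime {F : finFieldType} (g x : F) (log : F -> nat) :
  (#|F|.-1).-primitive_root g -> (forall x, x != 0 -> g ^+ log x = x) ->
  primitive_elt x = (x != 0) && coprime (log x) #|F|.-1.
Proof.
move=> g_prim logK; have q1_gt0 := prim_order_gt0 g_prim.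
rewrite /primitive_elt; have [->|x0] := eqVneq x 0; last first.
  by rewrite -{1}(logK x x0) (prim_root_exp_coprime _ g_prim).
apply/negP => /prim_expr_order/eqP.
by rewrite expr0n -leqn0 leqNgt q1_gt0 eq_sym oner_eq0.
Qed.

(** The conjugation is vacuous on a real indicator, but makes its later expansion run over conjugate
    characters. *)
Lemma Nuv_sum {F : finFieldType} (u v : F) :
  (Nuv u v)%:R = \sum_a \sum_b (primitive_elt a)%:R * (primitive_elt b)%:R *
    ((primitive_elt (u * a + v * b))%:R^* * (primitive_elt (v * a^-1 + u * b^-1))%:R) :> algC.
Proof.
rewrite /Nuv cardsE -sum1_card natr_sum big_mkcond /= pair_bigA; apply: eq_bigr => -[a b] _.
by rewrite conjC_nat -!natrM !mulnb -andbA unfold_in /=; case: ifP.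
Qed.

Lemma sum_distr4 (K : comNzRingType) (T : finType) (f1 f2 f3 f4 : T -> K) :
  (\sum_t f1 t) * (\sum_t f2 t) * ((\sum_t f3 t) * (\sum_t f4 t)) =
  \sum_(t : (T * T) * (T * T)) f1 t.1.1 * f2 t.1.2 * (f3 t.2.1 * f4 t.2.2).
Proof. by rewrite 2!big_distrlr !pair_bigA big_distrlr pair_bigA. Qed.

(** Lets the prescribed fourth character cost a factor 1, so that the error carries [W^3] instead of
    [W^4]. *)
Lemma sum_inj_eq_le1 (T : finType) (w : T -> algC) (x : algC) :
  injective w -> \sum_t (w t == x)%:R <= 1 :> algC.
Proof.
move=> w_inj; case: (pickP (fun t => w t == x)) => [t0 /eqP <-|none].
  rewrite (bigD1 t0) //= eqxx big1 ?addr0 // => t; rewrite (inj_eq w_inj).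
  by move/negPf->.
by rewrite big1 // => t _; rewrite none.
Qed.

Lemma Nuv_bound_algC {F : finFieldType} (u v : F) (n := #|F|.-1) :
  (3 < #|F|)%N -> u != 0 -> v != 0 ->
  `|(Nuv u v)%:R - thetaf algC n ^+ 3 * tauf algC n * n%:R * #|F|%:R| <=
  thetaf algC n ^+ 4 * (Wf n)%:R ^+ 3 * n%:R * sqrtC #|F|%:R.
Proof.
move=> q_gt3 u0 v0.
have [g g_prim] := finField_prim_root_exists F.
have [log logK] := finField_log_exists g g_prim.
have n_gt0 : (0 < n)%N by apply: prim_order_gt0 g_prim.
have pr_primes : all prime (primes n) by apply/allP => l; rewrite mem_primes => /andP[].
have [T [h [w [[w_inj w_P] h_bd h_sum h4_sum h_ind]]]] :=
  coprime_fourier _ (primes_uniq n) pr_primes.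
(* The radical of [n] divides [n]. *)
have w1 t : w t ^+ n = 1.
  suff /dvdnP[k ->] : (\prod_(l <- primes n) l %| n)%N by rewrite mulnC exprM w_P expr1n.
  rewrite {2}(prod_prime_decomp n_gt0) prime_decompE big_map /=.
  rewrite !big_seq; elim/big_ind2: _ => // [a b c d|l l_n]; first exact: dvdn_mul.
  by rewrite -{1}(expn1 l) dvdn_exp2l // logn_gt0.
have [th thE] : exists th : algC, thetaf algC n = th by exists (thetaf algC n).
have prim_sum x : (primitive_elt x)%:R = \sum_t th * h t * pow_char log (w t) x :> algC.
  rewrite (primitive_elt_coprime g x log g_prim logK) /pow_char.
  have [_|x0] /= := eqVneq x 0; first by rewrite big1 // => t _; rewrite mulr0.
  rewrite coprime_all_primes // h_ind -thetaf_prod // thE mulr_sumr.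
  by apply: eq_bigr => t _; rewrite mulrA.
have th_ge0 : 0 <= th by rewrite -thE divr_ge0 ?ler0n.
pose H (t : (T * T) * (T * T)) : algC := h t.1.1 * h t.1.2 * (h t.2.1 * h t.2.2).
pose S (t : (T * T) * (T * T)) : algC :=
  form_sum log u v (w t.1.1) (w t.1.2) (w t.2.1) (w t.2.2).
pose D (t : (T * T) * (T * T)) :=
  [&& w t.1.1 == w t.2.2, w t.1.2 == w t.2.2 & w t.2.1 == w t.2.2].
have NE : (Nuv u v)%:R = th ^+ 4 * \sum_t H t * S t.
  rewrite Nuv_sum.
  transitivity (\sum_a \sum_b \sum_(t : (T * T) * (T * T)) th ^+ 4 * H t *
      (pow_char log (w t.1.1) a * pow_char log (w t.1.2) b *
       ((pow_char log (w t.2.1) (u * a + v * b))^* *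
        pow_char log (w t.2.2) (v * a^-1 + u * b^-1)))).
    apply: eq_bigr => a _; apply: eq_bigr => b _.
    rewrite !prim_sum rmorph_sum sum_distr4; apply: eq_bigr => t _.
    rewrite 2!rmorphM /= (CrealP (proj1 (h_bd _))) (CrealP (ger0_real th_ge0)) /H.
    by move: (pow_char log _ _)^* => x; ring.
  under eq_bigr => a _ do rewrite exchange_big /=.
  rewrite exchange_big /= [RHS]mulr_sumr. apply: eq_bigr => t _.
  rewrite mulrA /S /form_sum mulr_sumr; apply: eq_bigr => a _.
  by rewrite mulr_sumr.
(* By injectivity of [w], the condition [D] selects exactly the diagonal quadruples, where [H] is
   [h t ^+ 4]. *)
have mainE : th ^+ 3 * tauf algC n * n%:R * #|F|%:R =
    th ^+ 4 * \sum_t H t * ((D t)%:R * n%:R * #|F|%:R).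
  have -> : \sum_t H t * ((D t)%:R * n%:R * #|F|%:R) = (\sum_t h t ^+ 4) * (n%:R * #|F|%:R).
    rewrite mulr_suml (bigID D) /= [X in _ + X]big1 ?addr0 => [|t /negPf ->]; last first.
      by rewrite !mul0r mulr0.
    rewrite (reindex_onto (fun t => ((t, t), (t, t))) (fun t => t.2.2)) /=; last first.
      by case=> -[a b] [c d] /and3P[/eqP/w_inj/= -> /eqP/w_inj/= -> /eqP/w_inj/= ->].
    by apply: eq_big => [t|t _]; rewrite /D /H /= !eqxx //=; ring.
  by rewrite h4_sum -thetaf_tauf // thE; ring.
rewrite thE mainE NE -mulrBr normrM ger0_norm ?exprn_ge0 //.
rewrite -[leRHS]mulrA -[leRHS]mulrA ler_wpM2l ?exprn_ge0 //.
rewrite -sumrB; apply: le_trans (ler_norm_sum _ _ _) _.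
have q_gt0 : (0 < #|F|)%N by apply: leq_trans q_gt3.
have nq_ge0 : 0 <= n%:R * sqrtC #|F|%:R :> algC by rewrite mulr_ge0 ?sqrtC_ge0 ?ler0n.
(* The fourth weight is bounded by 1; its index survives only in the indicator. *)
apply: (@le_trans _ _ (\sum_(t : (T * T) * (T * T))
   `|h t.1.1| * `|h t.1.2| * (`|h t.2.1| * (w t.2.2 == w t.1.1 * w t.1.2 * (w t.2.1)^*)%:R)
    * (n%:R * sqrtC #|F|%:R))).
  apply: ler_sum => t _; rewrite -mulrBr normrM.
  have S_bd := norm_form_sum F g log g_prim logK u v _ _ _ _ q_gt3 u0 v0
    (w1 t.1.1) (w1 t.1.2) (w1 t.2.1) (w1 t.2.2).
  apply: le_trans (ler_wpM2l (normr_ge0 _) S_bd) _.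
  rewrite -[_%:R * _ * _]mulrA [leLHS]mulrA ler_wpM2r // /H !normrM.
  rewrite -[leLHS]mulrA ler_wpM2l ?mulr_ge0 // -mulrA ler_wpM2l // ler_piMl ?ler0n //.
  exact: proj2 (h_bd _).
rewrite -mulr_suml ler_wpM2r //.
rewrite /Wf /omega natrX -h_sum -(pair_bigA _ (fun p r => `|h p.1| * `|h p.2| *
  (`|h r.1| * (w r.2 == w p.1 * w p.2 * (w r.1)^*)%:R))) /=.
have -> : (\sum_t `|h t|) ^+ 3 = \sum_(p : T * T) `|h p.1| * `|h p.2| * \sum_t `|h t|.
  by rewrite -mulr_suml -(pair_bigA _ (fun i j => `|h i| * `|h j|)) -big_distrlr /=; ring.
apply: ler_sum => p _; rewrite -mulr_sumr ler_wpM2l ?mulr_ge0 //.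
rewrite -(pair_bigA _ (fun r1 r2 => `|h r1| * (w r2 == w p.1 * w p.2 * (w r1)^*)%:R)) /=.
apply: ler_sum => t _; rewrite -mulr_sumr ler_piMr //.
exact: sum_inj_eq_le1.
Qed.

(** * Rationality, the field of three elements, and transfer to real closed fields *)

Lemma ratr_thetaf (K : numFieldType) (n : nat) : ratr (thetaf rat n) = thetaf K n.
Proof. by rewrite /thetaf fmorph_div /= !ratr_nat. Qed.

Lemma ratr_tauf (K : numFieldType) (n : nat) : ratr (tauf rat n) = tauf K n.
Proof.
rewrite /tauf rmorph_prod; apply: eq_bigr => l _.
by rewrite rmorphD rmorphB !fmorph_div rmorphXn rmorphB !rmorph1 /= ratr_nat.
Qed.

Lemma primitive_elt_card3 {F : finFieldType} (x : F) :
  #|F| = 3%N -> primitive_elt x -> x = -1.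
Proof.
rewrite /primitive_elt => -> /= x_prim; have /eqP := prim_expr_order x_prim.
rewrite sqrf_eq1 => /orP[/eqP x1|/eqP //].
by have := prim_order_dvd x_prim 1; rewrite x1 expr1n eqxx.
Qed.

Lemma Nuv_card3_le1 {F : finFieldType} (u v : F) : #|F| = 3%N -> (Nuv u v <= 1)%N.
Proof.
move=> q3; rewrite -(cards1 (-1 : F, -1 : F)); apply: subset_leq_card.
apply/subsetP => -[a b]; rewrite !inE => /and4P[/= a_prim b_prim _ _].
by rewrite (primitive_elt_card3 _ q3 a_prim) (primitive_elt_card3 _ q3 b_prim).
Qed.

Theorem theorem1p3 (R : rcfType) (F : finFieldType) (u v : F)
  (hq : (2 < #|F|)%N) (hu : u != 0) (hv : v != 0) :
  let q : nat := #|F| in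
  let theta : R := thetaf R q.-1 in
  let tau : R := tauf R q.-1 in
  let W : R := (Wf q.-1)%:R in
  `| (Nuv u v)%:R - theta ^+ 3 * tau * q.-1%:R * q%:R |
    <= theta ^+ 4 * W ^+ 3 * q.-1%:R * Num.sqrt (q%:R).
Proof.
cbv zeta; move: hq; set q := #|F|; rewrite leq_eqVlt => /orP[/eqP q3|q_gt3].
  (* Here theta is 1/2, tau is 1 and W is 2: the main term is 3/4 and the bound is the square root
     of 3, while the count is 0 or 1. *)
  rewrite -q3 /= /thetaf /tauf /Wf /omega.
  have -> : primes 2 = [:: 2%N] by [].
  have -> : totient 2 = 1%N by [].
  have sqrt_ge1 : 1 <= Num.sqrt 3%:R :> R by rewrite -[leLHS]sqrtr1 ler_wsqrtr // ler1n.
  have := Nuv_card3_le1 u v (esym q3); rewrite big_seq1 /=.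
  rewrite -(ler_nat R) => N_le1; have N_ge0 := ler0n R (Nuv u v).
  have -> : 2%:R - 1 = 1 :> R by ring.
  rewrite expn1 expr1n ler_norml; apply/andP; split; lra.
pose X : rat := (Nuv u v)%:R - thetaf rat q.-1 ^+ 3 * tauf rat q.-1 * q.-1%:R * q%:R.
pose Y : rat := thetaf rat q.-1 ^+ 4 * (Wf q.-1)%:R ^+ 3 * q.-1%:R.
have XE (K : numFieldType) : ratr X =
    (Nuv u v)%:R - thetaf K q.-1 ^+ 3 * tauf K q.-1 * q.-1%:R * q%:R.
  by rewrite /X rmorphB 3!rmorphM rmorphXn /= ratr_thetaf ratr_tauf !ratr_nat.
have YE (K : numFieldType) : ratr Y = thetaf K q.-1 ^+ 4 * (Wf q.-1)%:R ^+ 3 * q.-1%:R.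
  by rewrite /Y 2!rmorphM 2!rmorphXn /= ratr_thetaf !ratr_nat.
have Y_ge0 : 0 <= Y.
  by do ?[apply: mulr_ge0 | apply: exprn_ge0]; rewrite ?invr_ge0 ?ler0n.
(* Squaring removes the root of [q], leaving an inequality between rationals that can be read in
   [algC] and in [R] alike. *)
have XY : X ^+ 2 <= Y ^+ 2 * q%:R.
  have := Nuv_bound_algC u v q_gt3 hu hv; rewrite -XE -YE => XY.
  rewrite -(real_normK (num_real X)) -(ler_rat algC) rmorphXn rmorphM rmorphXn /= ratr_nat.
  rewrite -[X in _ * X]sqrtCK -exprMn ler_pXn2r // ?nnegrE ?ratr_norm //.
  by rewrite mulr_ge0 ?ler0q ?sqrtC_ge0 ?ler0n.
have rY_ge0 : 0 <= ratr Y :> R by rewrite ler0q.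
rewrite -XE -YE -(@ler_pXn2r _ 2) ?nnegrE ?(mulr_ge0 rY_ge0) ?sqrtr_ge0 //.
rewrite exprMn sqr_sqrtr ?ler0n // real_normK ?num_real //.
by rewrite -(ratr_nat R) -!rmorphXn -rmorphM ler_rat.
Qed.
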